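(* Let $p$ be an odd prime and $\chi$ a Dirichlet character with odd conductor $f$. There exists a unique continuous function $\ell_{p,E}(s,\chi)$ of $s\in\mathbb Z_p$ (with values in $\mathbb C_p$) such that $$\ell_{p,E}(1-n,\chi)=(1-p^n\chi_n(p))\,\ell_E(-n,\chi_n)\quad\text{for all } n\geq1.$$
   Context: For a primitive Dirichlet character $\psi$ of odd conductor $f_\psi$, the generalized Euler numbers $E_{n,\psi}$ are defined by $2\sum_{a=1}^{f_\psi}\frac{(-1)^a\psi(a)e^{at}}{e^{f_\psi t}+1}=\sum_{n\ge0}E_{n,\psi}\frac{t^n}{n!}$; the Euler $\ell$-function $\ell_E(s,\psi)=2\sum_{n\ge1}(-1)^n\psi(n)n^{-s}$ continues analytically to $\mathbb C$ with $\ell_E(-n,\psi)=E_{n,\psi}\in\mathbb Q(\psi)\subset\overline{\mathbb Q}_p$ for $n\ge0$. Let $\omega$ be the Teichmüller character mod $p$; for $n\ge0$, $\chi_n$ is the primitive Dirichlet character associated with $a\mapsto\chi(a)\omega^{-n}(a)$ on $(\mathbb Z/\mathrm{lcm}(f,p)\mathbb Z)^\times$. *)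

(* Defs.v *)
From HB Require Import structures.
From mathcomp Require Import all_boot all_order all_algebra.
From mathcomp Require Import reals.
Set Implicit Arguments. Unset Strict Implicit. Unset Printing Implicit Defensive.
Import Order.TTheory GRing.Theory Num.Theory.
Local Open Scope ring_scope.

(* ---------- The coefficient field: an abstract model of C_p ---------- *)

Definition padic_abs (p : nat) (R : realType) (C : fieldType) (abs : C -> R) : Prop :=
  [/\ forall x, abs x = 0 <-> x = 0,
      forall x, 0 <= abs x,
      forall x y, abs (x * y) = abs x * abs y,
      forall x y, abs (x + y) <= Num.max (abs x) (abs y)
    & abs (p%:R) = (p%:R)^-1 ].

Definition abs_complete (R : realType) (C : fieldType) (abs : C -> R) : Prop :=
  forall u : nat -> C,
    (forall eps : R, 0 < eps -> exists N : nat, forall m n : nat,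
        (N <= m)%N -> (N <= n)%N -> abs (u m - u n) < eps) ->
    exists l : C, forall eps : R, 0 < eps -> exists N : nat, forall n : nat,
        (N <= n)%N -> abs (u n - l) < eps.

Record PadicInt (p : nat) := MkPadicInt {
  zp_seq : nat -> nat ;
  zp_lt : forall k, (zp_seq k < p ^ k)%N ;
  zp_compat : forall k, (zp_seq k.+1 %% p ^ k)%N = zp_seq k }.

Definition zp_is_int (p : nat) (x : PadicInt p) (z : int) : Prop :=
  forall k, (zp_seq x k)%:Z = (z %% (p ^ k)%:Z)%Z.

(* Continuity of a function Z_p -> C (the sets x + p^k Z_p form a
   neighbourhood basis of x). *)
Definition zp_continuous (p : nat) (R : realType) (C : fieldType) (abs : C -> R)
  (L : PadicInt p -> C) : Prop :=
  forall (x : PadicInt p) (eps : R), 0 < eps -> exists k : nat, forall y : PadicInt p,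
    zp_seq y k = zp_seq x k -> abs (L y - L x) < eps.

Definition dchar_mod (C : fieldType) (m : nat) (chi : nat -> C) : Prop :=
  [/\ (0 < m)%N,
      forall a, chi (a + m)%N = chi a,
      forall a b, chi (a * b)%N = chi a * chi b,
      forall a, chi a = 0 <-> ~~ coprime a m
    & chi 1%N = 1 ].

Definition induced_from (C : fieldType) (m d : nat) (chi : nat -> C) : Prop :=
  exists psi : nat -> C, dchar_mod d psi /\
    forall a, coprime a m -> chi a = psi a.

Definition primitive_char (C : fieldType) (f : nat) (chi : nat -> C) : Prop :=
  dchar_mod f chi /\
  forall d, (d %| f)%N -> (d < f)%N -> ~ induced_from f d chi.

Definition teichmuller (p : nat) (R : realType) (C : fieldType) (abs : C -> R)
  (omega : nat -> C) : Prop :=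
  forall a : nat,
    ((p %| a)%N -> omega a = 0) /\
    (~~ (p %| a)%N -> omega a ^+ p.-1 = 1 /\ abs (omega a - a%:R) < 1).

Definition is_chi_n (C : fieldType) (p f : nat) (chi omega : nat -> C) (n : nat)
  (g : nat) (psi : nat -> C) : Prop :=
  primitive_char g psi /\
  forall a, coprime a (lcmn f p) -> psi a = chi a * (omega a) ^- n.

(* E_{n,psi} defined by 2 sum_{a=1}^{f} (-1)^a psi(a) e^{at}/(e^{ft}+1)
   = sum_n E_{n,psi} t^n/n!.  Comparing coefficients of t^n/n! in
   (e^{ft}+1) * G(t) = 2 sum_a (-1)^a psi(a) e^{at} gives
   2 E_n + sum_{k<n} C(n,k) f^(n-k) E_k = 2 sum_{a=1}^f (-1)^a psi(a) a^n,
   which determines E_n recursively (char C = 0). *)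
Definition euler_S (C : fieldType) (f : nat) (psi : nat -> C) (n : nat) : C :=
  \sum_(1 <= a < f.+1) (-1) ^+ a * psi a * (a%:R) ^+ n.

Fixpoint euler_list (C : fieldType) (f : nat) (psi : nat -> C) (n : nat) : seq C :=
  match n with
  | 0 => [:: euler_S f psi 0]
  | n'.+1 =>
      let s := euler_list f psi n' in
      rcons s (euler_S f psi n'.+1 -
               2%:R^-1 * \sum_(k < n'.+1) ('C(n'.+1, k))%:R * (f%:R) ^+ (n'.+1 - k)
                                          * nth 0 s k)
  end.

(* E_{n,psi} = ell_E(-n, psi), for psi primitive of (odd) conductor f. *)
Definition euler_num (C : fieldType) (f : nat) (psi : nat -> C) (n : nat) : C :=
  nth 0 (euler_list f psi n) n.

Definition euler_interp (p : nat) (C : fieldType) (f : nat) (chi omega : nat -> C)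
  (L : PadicInt p -> C) : Prop :=
  forall n : nat, (0 < n)%N ->
  forall x : PadicInt p, zp_is_int x (1 - n%:Z) ->
  forall (g : nat) (psi : nat -> C), is_chi_n p f chi omega n g psi ->
    L x = (1 - (p%:R) ^+ n * psi p) * euler_num g psi n.

(* Main.v *)
Require Import Defs.
From HB Require Import structures.
From mathcomp Require Import all_boot all_order all_algebra.
From mathcomp Require Import cyclic reals boolp ring.
Set Implicit Arguments. Unset Strict Implicit. Unset Printing Implicit Defensive.
Import Order.TTheory GRing.Theory Num.Theory.
Local Open Scope ring_scope.

(** Let [S_n(M, psi) = sum_(1 <= a <= M) (-1)^a psi(a) a^n]. For every odd multiple [M] of the
    period of [psi] one has [2 (S_n(M, psi) - E_(n,psi)) = sum_(k < n) C(n,k) M^(n-k) E_(k,psi)],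
    so [|E_(n,psi) - S_n(M, psi)| <= |M|]: the Euler numbers are [p]-adic limits of alternating
    power sums. Deleting the terms divisible by [p] from [S_n(pM, chi_n)] produces the Euler
    factor, and since [chi_n = chi omega^-n] at all integers prime to [p] (by primitivity of [chi]),
    [(1 - p^n chi_n(p)) E_(n,chi_n)] is the limit of the sums of [(-1)^a chi(a) <a>^n] over [a]
    prime to [p], where [<a> = a / omega(a)] satisfies [|<a> - 1| <= 1/p]. Hence these values
    are congruent modulo [p^k] as soon as the indices [n] are, and they extend to a continuous
    function on [Z_p], unique because the integers [1 - n] are dense. *)

(** * Euler numbers and alternating power sums *)

Lemma size_euler_list (C : fieldType) (f : nat) (psi : nat -> C) (n : nat) :
  size (euler_list f psi n) = n.+1.
Proof. by elim: n => //= n IH; rewrite size_rcons IH. Qed.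

Lemma nth_euler_list (C : fieldType) (f : nat) (psi : nat -> C) (n k : nat) :
  (k <= n)%N -> nth 0 (euler_list f psi n) k = euler_num f psi k.
Proof.
elim: n => [|n IH]; first by rewrite leqn0 => /eqP ->.
rewrite leq_eqVlt => /orP[/eqP -> //|kn].
by rewrite /= nth_rcons size_euler_list kn IH.
Qed.

Lemma euler_numE (C : fieldType) (f : nat) (psi : nat -> C) (n : nat) :
  euler_num f psi n = euler_S f psi n -
    2%:R^-1 * \sum_(k < n) 'C(n, k)%:R * f%:R ^+ (n - k) * euler_num f psi k.
Proof.
case: n => [|n]; first by rewrite big_ord0 mulr0 subr0.
rewrite {1}/euler_num /= nth_rcons size_euler_list ltnn eqxx.
congr (_ - _ * _); apply: eq_bigr => k _.
by rewrite nth_euler_list // -ltnS.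
Qed.

(** The umbral functional, that is, the linear form on polynomials taking [X^n] to [E_(n,psi)].
    Multiplication of the generating function by [e^(ct)] becomes the substitution of [X + c] for
    [X]. *)
Definition euler_umbral (C : fieldType) (f : nat) (psi : nat -> C)
  (P : {poly C}) : C := \sum_(i < size P) P`_i * euler_num f psi i.

Lemma euler_umbral_widen (C : fieldType) (f : nat) (psi : nat -> C)
  (P : {poly C}) (m : nat) : (size P <= m)%N ->
  euler_umbral f psi P = \sum_(i < m) P`_i * euler_num f psi i.
Proof.
move=> Pm; rewrite /euler_umbral.
rewrite (big_ord_widen m (fun i => P`_i * euler_num f psi i)) // big_mkcond.
apply: eq_bigr => i _; case: ltnP => // le_Pi.
by rewrite nth_default ?mul0r.
Qed.

Lemma euler_umbral_sum (C : fieldType) (f : nat) (psi : nat -> C) (n : nat)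
  (c : nat -> C) (P : nat -> {poly C}) :
  euler_umbral f psi (\sum_(i < n) c i *: P i) =
  \sum_(i < n) c i * euler_umbral f psi (P i).
Proof.
elim: n => [|n IH].
  by rewrite !big_ord0 /euler_umbral size_poly0 big_ord0.
rewrite !big_ord_recr /= -IH; set Q := \sum_(i < n) _.
set m := maxn (size Q) (size (P n)).
have leQ : (size Q <= m)%N by rewrite leq_maxl.
have leP : (size (P n) <= m)%N by rewrite leq_maxr.
rewrite (euler_umbral_widen f psi leQ) (euler_umbral_widen f psi leP).
rewrite (euler_umbral_widen f psi (m := m)); last first.
  apply: leq_trans (size_polyD _ _) _; rewrite geq_max leQ /=.
  exact: leq_trans (size_scale_leq _ _) leP.
rewrite mulr_sumr -big_split /=; apply: eq_bigr => i _.
by rewrite coefD coefZ mulrDl mulrA.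
Qed.

Lemma euler_umbralXn (C : fieldType) (f : nat) (psi : nat -> C) (n : nat) :
  euler_umbral f psi 'X^n = euler_num f psi n.
Proof.
rewrite /euler_umbral size_polyXn big_ord_recr /= coefXn eqxx mul1r big1 ?add0r //.
by move=> i _; rewrite coefXn ltn_eqF ?mul0r.
Qed.

Lemma expXaddC (C : fieldType) (c : C) (n : nat) :
  ('X + c%:P) ^+ n = \sum_(k < n.+1) ('C(n, k)%:R * c ^+ (n - k)) *: 'X^k.
Proof.
rewrite addrC exprDn; apply: eq_bigr => k _.
by rewrite -mul_polyC polyCM polyC_exp polyC_natr; ring.
Qed.

Lemma euler_umbral_shift (C : fieldType) (f : nat) (psi : nat -> C) (c : C) (n : nat) :
  euler_umbral f psi (('X + c%:P) ^+ n) =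
  \sum_(k < n) 'C(n, k)%:R * c ^+ (n - k) * euler_num f psi k + euler_num f psi n.
Proof.
rewrite expXaddC (euler_umbral_sum f psi n.+1
  (fun k => 'C(n, k)%:R * c ^+ (n - k)) (fun k => 'X^k)).
rewrite big_ord_recr /= binn subnn expr0 !mul1r euler_umbralXn.
by congr (_ + _); apply: eq_bigr => k _; rewrite euler_umbralXn.
Qed.

(* The generating-function identity [(e^{ft} + 1) G(t) = 2 sum_a (-1)^a psi(a) e^{at}],
   read off on arbitrary polynomials instead of monomials. *)
Lemma euler_umbral_step (C : fieldType) (f : nat) (psi : nat -> C) (P : {poly C}) :
  2%:R != 0 :> C ->
  euler_umbral f psi (P \Po ('X + (f%:R)%:P)) + euler_umbral f psi P =
  2%:R * \sum_(1 <= a < f.+1) (-1) ^+ a * psi a * P.[a%:R].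
Proof.
move=> two_neq0; rewrite comp_polyE.
rewrite (euler_umbral_sum f psi (size P) (nth 0 P) (fun i => ('X + (f%:R)%:P) ^+ i)).
rewrite -big_split /=.
under eq_bigr => i _.
  rewrite euler_umbral_shift -mulrDr -addrA.
  have -> : \sum_(k < i) 'C(i, k)%:R * (f%:R : C) ^+ (i - k) * euler_num f psi k
      + (euler_num f psi i + euler_num f psi i) = 2%:R * euler_S f psi i.
    by rewrite [euler_num f psi i]euler_numE; field.
  rewrite mulrCA; over.
rewrite -mulr_sumr; congr (_ * _).
rewrite /euler_S; under [LHS]eq_bigr do rewrite mulr_sumr.
rewrite exchange_big /=; apply: eq_bigr => a _.
rewrite horner_coef mulr_sumr; apply: eq_bigr => i _; ring.
Qed.

Lemma euler_S_addn (C : fieldType) (f M n : nat) (psi : nat -> C) :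
  euler_S (M + f) psi n = euler_S M psi n +
    \sum_(1 <= a < f.+1) (-1) ^+ (a + M) * psi (a + M)%N * ((a + M)%:R) ^+ n.
Proof.
rewrite /euler_S (big_cat_nat (n := M.+1)) //=; last by rewrite ltnS leq_addr.
congr (_ + _).
have -> : M.+1 = (1 + M)%N by rewrite add1n.
rewrite big_addn.
by have -> : ((M + f).+1 - M = f.+1)%N by rewrite -addnS addKn.
Qed.

Lemma periodic_mul (C : Type) (m : nat) (psi : nat -> C) :
  (forall a, psi (a + m)%N = psi a) -> forall j a, psi (a + j * m)%N = psi a.
Proof.
move=> per; elim=> [|j IH] a; first by rewrite mul0n addn0.
by rewrite mulSn addnCA addnC per IH.
Qed.

Lemma periodic_modn (C : Type) (m : nat) (psi : nat -> C) :
  (forall a, psi (a + m)%N = psi a) -> forall a b, a = b %[mod m] -> psi a = psi b.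
Proof.
move=> per; suff red a : psi (a %% m)%N = psi a by move=> a b ab; rewrite -red ab red.
by rewrite [in RHS](divn_eq a m) addnC (periodic_mul per).
Qed.

(* The sum telescopes because successive blocks of [f] terms carry opposite signs. *)
Lemma euler_umbral_telescope (C : fieldType) (f : nat) (psi : nat -> C) (n r : nat) :
  2%:R != 0 :> C -> odd f -> (forall a, psi (a + f)%N = psi a) ->
  2%:R * euler_S (r * f) psi n = euler_num f psi n
    - (-1) ^+ r * euler_umbral f psi (('X + ((r * f)%:R)%:P) ^+ n).
Proof.
move=> two_neq0 odd_f per; elim: r => [|r IH].
  by rewrite mul0n addr0 euler_umbralXn expr0 mul1r subrr /euler_S big_geq // mulr0.
rewrite mulSn addnC euler_S_addn mulrDr IH.
(* As [f] is odd, [(-1)^(r f) = (-1)^r]; as [psi] has period [f], the new block only involves values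
   of the polynomial [(X + r f)^n], to which [euler_umbral_step] applies. *)
have -> : \sum_(1 <= a < f.+1) (-1) ^+ (a + r * f) * psi (a + r * f)%N * ((a + r * f)%:R) ^+ n
  = (-1) ^+ r * \sum_(1 <= a < f.+1) (-1) ^+ a * psi a * (('X + ((r * f)%:R)%:P) ^+ n).[a%:R].
  rewrite mulr_sumr; apply: eq_bigr => a _.
  rewrite (periodic_mul per) horner_exp hornerD hornerX hornerC exprD natrD.
  by rewrite mulnC exprM -[(-1) ^+ f]signr_odd odd_f expr1; ring.
rewrite mulrCA -euler_umbral_step // rmorphXn /= comp_polyD comp_polyX comp_polyC.
have -> : 'X + (f%:R)%:P + ((r * f)%:R)%:P = 'X + ((r * f + f)%:R)%:P :> {poly C}.
  by rewrite natrD polyCD; ring.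
rewrite exprS; ring.
Qed.

(** For odd [r] the sign in the telescoped identity becomes [+], so the top term of the shifted
    power supplies a second [E_n]; every remaining term has [k < n] and carries a factor [r f]. *)
Lemma euler_num_sum (C : fieldType) (f : nat) (psi : nat -> C) (n r : nat) :
  2%:R != 0 :> C -> odd f -> odd r -> (forall a, psi (a + f)%N = psi a) ->
  2%:R * (euler_S (r * f) psi n - euler_num f psi n) =
  \sum_(k < n) 'C(n, k)%:R * ((r * f)%:R) ^+ (n - k) * euler_num f psi k.
Proof.
move=> two_neq0 odd_f odd_r per.
rewrite mulrBr euler_umbral_telescope // -signr_odd odd_r expr1 euler_umbral_shift.
ring.
Qed.

(** * Ultrametric absolute values *)

Lemma padic_abs0 (p : nat) (R : realType) (C : fieldType) (abs : C -> R) :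
  padic_abs p abs -> abs 0 = 0.
Proof. by case=> abs_eq0 _ _ _ _; apply/abs_eq0. Qed.

Lemma padic_abs_ge0 (p : nat) (R : realType) (C : fieldType) (abs : C -> R) (x : C) :
  padic_abs p abs -> 0 <= abs x.
Proof. by case. Qed.

Lemma padic_absM (p : nat) (R : realType) (C : fieldType) (abs : C -> R) (x y : C) :
  padic_abs p abs -> abs (x * y) = abs x * abs y.
Proof. by case. Qed.

Lemma padic_abs1 (p : nat) (R : realType) (C : fieldType) (abs : C -> R) :
  padic_abs p abs -> abs 1 = 1.
Proof.
case=> abs_eq0 _ absM _ _.
have abs1_neq0 : abs 1 != 0 by apply/eqP => /abs_eq0 /eqP; rewrite oner_eq0.
by apply: (mulfI abs1_neq0); rewrite -absM !mulr1.
Qed.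

Lemma padic_absX (p : nat) (R : realType) (C : fieldType) (abs : C -> R) (x : C) (n : nat) :
  padic_abs p abs -> abs (x ^+ n) = abs x ^+ n.
Proof.
move=> Habs; elim: n => [|n IH]; first by rewrite !expr0 (padic_abs1 Habs).
by rewrite !exprS (padic_absM _ _ Habs) IH.
Qed.

Lemma padic_abs_root1 (p : nat) (R : realType) (C : fieldType) (abs : C -> R)
    (x : C) (n : nat) :
  padic_abs p abs -> (0 < n)%N -> x ^+ n = 1 -> abs x = 1.
Proof.
move=> Habs n_gt0 xn1; apply/eqP.
rewrite -(pexpr_eq1 n_gt0 (padic_abs_ge0 x Habs)).
by rewrite -(padic_absX _ _ Habs) xn1 (padic_abs1 Habs).
Qed.

Lemma padic_absN (p : nat) (R : realType) (C : fieldType) (abs : C -> R) (x : C) :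
  padic_abs p abs -> abs (- x) = abs x.
Proof.
move=> Habs; rewrite -mulN1r (padic_absM _ _ Habs).
by rewrite (@padic_abs_root1 _ _ _ _ (-1) 2 Habs) ?mul1r // sqrrN expr1n.
Qed.

Lemma padic_absB (p : nat) (R : realType) (C : fieldType) (abs : C -> R) (x y : C) :
  padic_abs p abs -> abs (x - y) = abs (y - x).
Proof. by move=> Habs; rewrite -opprB (padic_absN _ Habs). Qed.

Lemma padic_abs_leD (p : nat) (R : realType) (C : fieldType) (abs : C -> R)
    (x y : C) (b : R) :
  padic_abs p abs -> abs x <= b -> abs y <= b -> abs (x + y) <= b.
Proof.
by case=> _ _ _ absD _ xb yb; apply: le_trans (absD _ _) _; rewrite ge_max xb yb.
Qed.

Lemma padic_abs_leB (p : nat) (R : realType) (C : fieldType) (abs : C -> R)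
    (x y : C) (b : R) :
  padic_abs p abs -> abs x <= b -> abs y <= b -> abs (x - y) <= b.
Proof.
by move=> Habs xb yb; apply: (padic_abs_leD Habs) => //; rewrite (padic_absN _ Habs).
Qed.

Lemma padic_abs_le_dist (p : nat) (R : realType) (C : fieldType) (abs : C -> R)
    (x y z : C) (b : R) :
  padic_abs p abs -> abs (x - y) <= b -> abs (y - z) <= b -> abs (x - z) <= b.
Proof. by move=> Habs xy yz; rewrite -(subrKA y); apply: (padic_abs_leD Habs). Qed.

Lemma padic_abs_lt_dist (p : nat) (R : realType) (C : fieldType) (abs : C -> R)
    (x y z : C) (b : R) :
  padic_abs p abs -> abs (x - y) < b -> abs (y - z) < b -> abs (x - z) < b.
Proof.
case=> _ _ _ absD _ xy yz; rewrite -(subrKA y).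
by apply: le_lt_trans (absD _ _) _; rewrite gt_max xy yz.
Qed.

Lemma padic_abs_le_sum (p : nat) (R : realType) (C : fieldType) (abs : C -> R)
    (I : Type) (r : seq I) (F : I -> C) (b : R) :
  padic_abs p abs -> 0 <= b -> (forall i, abs (F i) <= b) ->
  abs (\sum_(i <- r) F i) <= b.
Proof.
move=> Habs b_ge0 Fb; elim/big_rec: _ => [|i x _ xb]; first by rewrite (padic_abs0 Habs).
exact: (padic_abs_leD Habs).
Qed.

Lemma padic_abs_leM (p : nat) (R : realType) (C : fieldType) (abs : C -> R)
    (x y : C) (b : R) :
  padic_abs p abs -> abs x <= 1 -> abs y <= b -> abs (x * y) <= b.
Proof.
move=> Habs x1 yb; rewrite (padic_absM _ _ Habs) -[b]mul1r.
by apply: ler_pM => //; apply: padic_abs_ge0 _ Habs.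
Qed.

Lemma padic_abs_nat (p : nat) (R : realType) (C : fieldType) (abs : C -> R) (n : nat) :
  padic_abs p abs -> abs n%:R <= 1.
Proof.
move=> Habs; elim: n => [|n IH]; first by rewrite (padic_abs0 Habs).
by rewrite -natr1; apply: (padic_abs_leD Habs) => //; rewrite (padic_abs1 Habs).
Qed.

Lemma padic_abs_leX (p : nat) (R : realType) (C : fieldType) (abs : C -> R) (x : C) (n : nat) :
  padic_abs p abs -> abs x <= 1 -> abs (x ^+ n) <= 1.
Proof.
by move=> Habs x1; rewrite (padic_absX _ _ Habs) exprn_ile1 ?(padic_abs_ge0 _ Habs).
Qed.

Lemma padic_abs_dvd (p : nat) (R : realType) (C : fieldType) (abs : C -> R) (k n : nat) :
  padic_abs p abs -> (p ^ k %| n)%N -> abs n%:R <= p%:R^-1 ^+ k.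
Proof.
move=> Habs /dvdnP[c ->]; rewrite natrM; apply: (padic_abs_leM Habs).
  exact: padic_abs_nat _ Habs.
by rewrite natrX (padic_absX _ _ Habs); case: Habs => _ _ _ _ ->.
Qed.

Lemma prime_invr_lt1 (p : nat) (R : realType) : prime p -> (p%:R : R)^-1 < 1.
Proof.
move=> pr_p; rewrite invf_lt1 ?ltr0n ?prime_gt0 //.
by rewrite ltr1n prime_gt1.
Qed.


Lemma expn_predp_mod (p a : nat) : prime p -> ~~ (p %| a)%N ->
  exists c : nat, (a ^ p.-1 = c * p + 1)%N.
Proof.
move=> pr_p pa; exists (a ^ p.-1 %/ p)%N.
have -> : p.-1 = totient p by rewrite -{2}[p]expn1 totient_pfactor // expn0 muln1.
have co_ap : coprime a p by rewrite coprime_sym prime_coprime.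
rewrite {1}(divn_eq (a ^ totient p) p) (Euler_exp_totient co_ap).
by rewrite modn_small ?prime_gt1.
Qed.

(** If [a] had absolute value below 1, Fermat's congruence [a^(p-1) = c p + 1] would make 1 a
    difference of two elements of absolute value below 1. *)
Lemma padic_abs_unit (p : nat) (R : realType) (C : fieldType) (abs : C -> R) (a : nat) :
  prime p -> padic_abs p abs -> ~~ (p %| a)%N -> abs a%:R = 1.
Proof.
move=> pr_p Habs pa; apply/eqP; rewrite eq_le (padic_abs_nat _ Habs) /=.
rewrite leNgt; apply/negP => a_lt1.
have [c ac] := expn_predp_mod pr_p pa.
have : abs ((a ^ p.-1)%:R - (c * p)%:R) = 1.
  by rewrite ac natrD addrAC subrr add0r (padic_abs1 Habs).
apply/eqP; rewrite lt_eqF //; rewrite -[X in X - _]subr0.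
apply: (@padic_abs_lt_dist _ _ _ _ _ 0 _ _ Habs); rewrite ?subr0.
  rewrite natrX (padic_absX _ _ Habs) exprn_ilt1 ?(padic_abs_ge0 _ Habs) //.
  by rewrite -lt0n -subn1 subn_gt0 prime_gt1.
rewrite sub0r (padic_absN _ Habs).
apply: le_lt_trans (prime_invr_lt1 R pr_p); rewrite -[_^-1]expr1.
by apply: (padic_abs_dvd Habs); rewrite expn1 dvdn_mull.
Qed.

Lemma padic_abs_2 (p : nat) (R : realType) (C : fieldType) (abs : C -> R) :
  prime p -> odd p -> padic_abs p abs -> abs 2%:R = 1.
Proof.
move=> pr_p odd_p Habs; apply: (padic_abs_unit pr_p Habs).
by rewrite dvdn_prime2 //; apply: contraL odd_p => /eqP ->.
Qed.

Lemma padic_two_neq0 (p : nat) (R : realType) (C : fieldType) (abs : C -> R) :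
  prime p -> odd p -> padic_abs p abs -> 2%:R != 0 :> C.
Proof.
move=> pr_p odd_p Habs; apply/eqP => two0; have := padic_abs_2 pr_p odd_p Habs.
by rewrite two0 (padic_abs0 Habs) => /eqP; rewrite eq_sym oner_eq0.
Qed.

Lemma padic_abs_inv2 (p : nat) (R : realType) (C : fieldType) (abs : C -> R) :
  prime p -> odd p -> padic_abs p abs -> abs 2%:R^-1 = 1.
Proof.
move=> pr_p odd_p Habs; have := padic_absM 2%:R 2%:R^-1 Habs.
rewrite divff ?(padic_two_neq0 pr_p odd_p Habs) // (padic_abs1 Habs).
by rewrite (padic_abs_2 pr_p odd_p Habs) mul1r.
Qed.

Lemma prime_invX_lt (p : nat) (R : realType) (eps : R) :
  prime p -> 0 < eps -> exists k : nat, p%:R^-1 ^+ k < eps.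
Proof.
move=> pr_p eps_gt0; exists (Num.bound eps^-1); set k := Num.bound _.
have lt_k : eps^-1 < k%:R by apply: archi_boundP; rewrite invr_ge0 ltW.
rewrite exprVn invf_plt ?posrE ?exprn_gt0 ?ltr0n ?prime_gt0 //.
by apply: lt_trans lt_k _; rewrite -natrX ltr_nat ltn_expl ?prime_gt1.
Qed.

Lemma padic_abs_eq (p : nat) (R : realType) (C : fieldType) (abs : C -> R) (x y : C) :
  prime p -> padic_abs p abs -> (forall k, abs (x - y) <= p%:R^-1 ^+ k) -> x = y.
Proof.
move=> pr_p Habs le_k; apply/eqP; rewrite -subr_eq0; apply/eqP.
case: (Habs) => abs_eq0 _ _ _ _; apply/abs_eq0/eqP.
rewrite eq_le (padic_abs_ge0 _ Habs) andbT leNgt; apply/negP => d_gt0.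
by have [k] := prime_invX_lt pr_p d_gt0; rewrite ltNge le_k.
Qed.

(** * Estimates for Euler numbers and for powers of elements near 1 *)

Lemma padic_abs_euler_S_le1 (p : nat) (R : realType) (C : fieldType) (abs : C -> R)
    (f : nat) (psi : nat -> C) (n : nat) :
  padic_abs p abs -> (forall a, abs (psi a) <= 1) -> abs (euler_S f psi n) <= 1.
Proof.
move=> Habs psi1; rewrite /euler_S; apply: (padic_abs_le_sum _ Habs) => // a.
apply: (padic_abs_leM Habs); last exact: padic_abs_leX _ Habs (padic_abs_nat _ Habs).
apply: (padic_abs_leM Habs) => //; apply: (padic_abs_leX _ Habs).
by rewrite (padic_absN _ Habs) (padic_abs1 Habs).
Qed.

(** The recursion divides only by 2, which is a unit because [p] is odd. *)
Lemma padic_abs_euler_num_le1 (p : nat) (R : realType) (C : fieldType) (abs : C -> R)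
    (f : nat) (psi : nat -> C) (n : nat) :
  prime p -> odd p -> padic_abs p abs -> (forall a, abs (psi a) <= 1) ->
  abs (euler_num f psi n) <= 1.
Proof.
move=> pr_p odd_p Habs psi1; elim/ltn_ind: n => n IH; rewrite euler_numE.
apply: (padic_abs_leB Habs); first exact: padic_abs_euler_S_le1 _ _ Habs psi1.
apply: (padic_abs_leM Habs); first by rewrite (padic_abs_inv2 pr_p odd_p Habs).
apply: (padic_abs_le_sum _ Habs) => // k.
apply: (padic_abs_leM Habs); last exact: IH.
apply: (padic_abs_leM Habs); first exact: padic_abs_nat _ Habs.
exact: padic_abs_leX _ Habs (padic_abs_nat _ Habs).
Qed.

Lemma euler_num_approx (p : nat) (R : realType) (C : fieldType) (abs : C -> R)
    (f : nat) (psi : nat -> C) (n r k : nat) :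
  prime p -> odd p -> padic_abs p abs -> (forall a, abs (psi a) <= 1) ->
  odd f -> odd r -> (forall a, psi (a + f)%N = psi a) -> (p ^ k %| r * f)%N ->
  abs (euler_S (r * f) psi n - euler_num f psi n) <= p%:R^-1 ^+ k.
Proof.
move=> pr_p odd_p Habs psi1 odd_f odd_r per pk_dvd.
have -> (x : C) : abs x = abs (2%:R * x).
  by rewrite (padic_absM _ _ Habs) (padic_abs_2 pr_p odd_p Habs) mul1r.
rewrite (euler_num_sum _ (padic_two_neq0 pr_p odd_p Habs)) //.
apply: (padic_abs_le_sum _ Habs) => [|i].
  by rewrite exprn_ge0 ?invr_ge0.
(* Because [i < n], one factor [r f] splits off [(r f)^(n - i)]; it supplies the bound, everything
   else being integral. *)
rewrite -mulrA mulrCA -(subnSK (ltn_ord i)) exprSr -mulrA.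
apply: (padic_abs_leM Habs); first exact: padic_abs_leX _ Habs (padic_abs_nat _ Habs).
rewrite mulrC; apply: (padic_abs_leM Habs); last exact: (padic_abs_dvd Habs).
apply: (padic_abs_leM Habs); first exact: padic_abs_nat _ Habs.
exact: (padic_abs_euler_num_le1 _ _ pr_p odd_p Habs).
Qed.

(** A [p]-th power map brings an element within [1/p] of 1 closer to 1 by a factor [1/p], so
    [u^(p^k)] is within [p^-k] of 1. For [n <= m], the difference is [u^n] times a power of
    [u^(p^k)] minus 1. *)
Lemma padic_abs_exp_sub (p : nat) (R : realType) (C : fieldType) (abs : C -> R)
    (u : C) (k m n : nat) :
  prime p -> padic_abs p abs -> abs (u - 1) <= p%:R^-1 -> m = n %[mod p ^ k] ->
  abs (u ^+ m - u ^+ n) <= p%:R^-1 ^+ k.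
Proof.
move=> pr_p Habs u1.
have inv_ge0 : 0 <= (p%:R : R)^-1 by rewrite invr_ge0.
have inv_le1 : (p%:R : R)^-1 <= 1 by rewrite ltW ?prime_invr_lt1.
have abs_le1 v : abs (v - 1) <= p%:R^-1 -> abs v <= 1.
  move=> v1; rewrite -[v](subrK 1); apply: (padic_abs_leD Habs).
    exact: le_trans v1 _.
  by rewrite (padic_abs1 Habs).
have exp_dist v i : abs (v - 1) <= p%:R^-1 -> abs (v ^+ i - 1) <= abs (v - 1).
  move=> v1; rewrite subrX1 mulrC; apply: (padic_abs_leM Habs) => //.
  apply: (padic_abs_le_sum _ Habs) => // j.
  exact: padic_abs_leX _ Habs (abs_le1 _ v1).
have pow_p v : abs (v - 1) <= p%:R^-1 -> abs (v ^+ p - 1) <= abs (v - 1) * p%:R^-1.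
  move=> v1; rewrite subrX1 (padic_absM _ _ Habs).
  apply: ler_wpM2l; first exact: padic_abs_ge0 _ Habs.
  (* Each [v^i] is within [1/p] of 1, so the cofactor of [v - 1] equals [p] up to an error of size
     at most [1/p]. *)
  have -> : \sum_(i < p) v ^+ i = p%:R + \sum_(i < p) (v ^+ i - 1).
    by rewrite sumrB sumr_const card_ord; ring.
  apply: (padic_abs_leD Habs); first by case: Habs => _ _ _ _ ->.
  by apply: (padic_abs_le_sum _ Habs) => // i; apply: le_trans (exp_dist _ _ v1) v1.
have pow_pk j : abs (u ^+ (p ^ j) - 1) <= p%:R^-1 ^+ j * p%:R^-1.
  elim: j => [|j IH]; first by rewrite expn0 expr1 expr0 mul1r.
  rewrite expnSr exprM exprSr; apply: le_trans (pow_p _ _) _.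
    by apply: le_trans IH _; rewrite ler_piMl // exprn_ile1.
  exact: ler_wpM2r.
wlog le_nm : m n / (n <= m)%N.
  move=> H mn; have [/H->//|/ltnW /H le_mn] := leqP n m.
  by rewrite (padic_absB _ _ Habs) le_mn.
move/eqP; rewrite eqn_mod_dvd // => /dvdnP[c mn].
rewrite -(subnK le_nm) mn exprD -[X in _ - X]mul1r -mulrBl mulrC.
apply: (padic_abs_leM Habs); first exact: padic_abs_leX _ Habs (abs_le1 _ u1).
rewrite mulnC exprM.
have pkk : abs (u ^+ (p ^ k) - 1) <= p%:R^-1 ^+ k.
  by apply: le_trans (pow_pk k) _; rewrite ler_piMr // exprn_ge0.
apply: le_trans (exp_dist _ _ _) pkk.
by apply: le_trans (pow_pk k) _; rewrite ler_piMl // exprn_ile1.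
Qed.

(* [x - 1] divides [x ^+ p.-1 - 1], and the cofactor is congruent to [p - 1], hence a unit. *)
Lemma padic_abs_expB1 (p : nat) (R : realType) (C : fieldType) (abs : C -> R) (x : C) :
  prime p -> padic_abs p abs -> abs (x - 1) < 1 -> abs (x ^+ p.-1 - 1) = abs (x - 1).
Proof.
move=> pr_p Habs x1; rewrite subrX1 (padic_absM _ _ Habs).
set s := \sum_(i < _) _; suff -> : abs s = 1 by rewrite mulr1.
have x_le1 : abs x <= 1.
  rewrite -[x](subrK 1); apply: (padic_abs_leD Habs); first exact: ltW.
  by rewrite (padic_abs1 Habs).
have s_near : abs (s - (p.-1)%:R) < 1.
  have -> : s - (p.-1)%:R = \sum_(i < p.-1) (x ^+ i - 1).
    by rewrite sumrB sumr_const card_ord.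
  apply: le_lt_trans x1; apply: (padic_abs_le_sum _ Habs) => [|i].
    exact: padic_abs_ge0 _ Habs.
  rewrite subrX1 mulrC; apply: (padic_abs_leM Habs) => //.
  by apply: (padic_abs_le_sum _ Habs) => // j; apply: padic_abs_leX _ Habs x_le1.
have p1_unit : abs (p.-1)%:R = 1.
  apply: (padic_abs_unit pr_p Habs); rewrite gtnNdvd //.
    by rewrite -subn1 subn_gt0 prime_gt1.
  by rewrite prednK ?prime_gt0.
apply/eqP; rewrite eq_le; apply/andP; split.
  rewrite -[s](subrK (p.-1)%:R); apply: (padic_abs_leD Habs); first exact: ltW.
  by rewrite p1_unit.
rewrite leNgt; apply/negP => s_lt1.
have : abs ((p.-1)%:R - 0) < 1.
  apply: (@padic_abs_lt_dist _ _ _ _ _ s _ _ Habs); last by rewrite subr0.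
  by rewrite (padic_absB _ _ Habs).
by rewrite subr0 p1_unit ltxx.
Qed.

(** The quotient [x / y] is close to 1 and its power of exponent [p - 1] is 1; by [padic_abs_expB1]
    both are at the same distance from 1, which is therefore 0. *)
Lemma padic_root1_eq (p : nat) (R : realType) (C : fieldType) (abs : C -> R) (x y : C) :
  prime p -> padic_abs p abs -> x ^+ p.-1 = 1 -> y ^+ p.-1 = 1 -> abs (x - y) < 1 ->
  x = y.
Proof.
move=> pr_p Habs x1 y1 xy.
have p1_gt0 : (0 < p.-1)%N by rewrite -subn1 subn_gt0 prime_gt1.
have y_neq0 : y != 0.
  by apply: contra_eq_neq y1 => ->; rewrite expr0n gtn_eqF // eq_sym oner_eq0.
have xyE : x - y = (x / y - 1) * y by rewrite mulrBl divfK // mul1r.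
have d1 : abs (x / y - 1) < 1.
  by move: xy; rewrite xyE (padic_absM _ _ Habs) (padic_abs_root1 Habs p1_gt0 y1) mulr1.
have := padic_abs_expB1 pr_p Habs d1.
rewrite exprMn exprVn x1 y1 invr1 mulr1 subrr (padic_abs0 Habs) => /esym d0.
apply/eqP; rewrite -subr_eq0 xyE; case: Habs => abs_eq0 _ _ _ _.
by move/abs_eq0: d0 => ->; rewrite mul0r.
Qed.

(** * The Teichmueller character *)

Lemma teichmuller0 (p : nat) (R : realType) (C : fieldType) (abs : C -> R)
    (omega : nat -> C) (a : nat) :
  teichmuller p abs omega -> (p %| a)%N -> omega a = 0.
Proof. by move=> /(_ a)[]. Qed.

Lemma teichmuller_root1 (p : nat) (R : realType) (C : fieldType) (abs : C -> R)
    (omega : nat -> C) (a : nat) :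
  teichmuller p abs omega -> ~~ (p %| a)%N -> omega a ^+ p.-1 = 1.
Proof. by move=> /(_ a)[_ H] /H[]. Qed.

Lemma teichmuller_abs1 (p : nat) (R : realType) (C : fieldType) (abs : C -> R)
    (omega : nat -> C) (a : nat) :
  prime p -> padic_abs p abs -> teichmuller p abs omega -> ~~ (p %| a)%N ->
  abs (omega a) = 1.
Proof.
move=> pr_p Habs Hom pa; apply: (padic_abs_root1 Habs (n := p.-1)).
  by rewrite -subn1 subn_gt0 prime_gt1.
exact: teichmuller_root1 Hom pa.
Qed.

Lemma teichmuller_eq0 (p : nat) (R : realType) (C : fieldType) (abs : C -> R)
    (omega : nat -> C) (a : nat) :
  prime p -> padic_abs p abs -> teichmuller p abs omega ->
  (omega a == 0) = (p %| a)%N.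
Proof.
move=> pr_p Habs Hom; apply/idP/idP => [/eqP om0|pa]; last first.
  by rewrite (teichmuller0 Hom pa).
apply/negPn/negP => pa; have := teichmuller_abs1 pr_p Habs Hom pa.
by rewrite om0 (padic_abs0 Habs) => /eqP; rewrite eq_sym oner_eq0.
Qed.

(** The two defining conditions pin down each value; periodicity and multiplicativity of [omega] are
    deduced from this uniqueness. *)
Lemma teichmuller_uniq (p : nat) (R : realType) (C : fieldType) (abs : C -> R)
    (omega : nat -> C) (a : nat) (x : C) :
  prime p -> padic_abs p abs -> teichmuller p abs omega -> ~~ (p %| a)%N ->
  x ^+ p.-1 = 1 -> abs (x - a%:R) < 1 -> omega a = x.
Proof.
move=> pr_p Habs Hom pa x1 xa; case: (Hom a) => _ /(_ pa)[om1 oma].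
apply: (padic_root1_eq pr_p Habs) => //.
by apply: (padic_abs_lt_dist Habs) oma _; rewrite (padic_absB _ _ Habs).
Qed.

Lemma teichmuller_period (p : nat) (R : realType) (C : fieldType) (abs : C -> R)
    (omega : nat -> C) (a : nat) :
  prime p -> padic_abs p abs -> teichmuller p abs omega ->
  omega (a + p)%N = omega a.
Proof.
move=> pr_p Habs Hom; have pap : (p %| a + p)%N = (p %| a)%N by rewrite dvdn_addl.
have [pa|pa] := boolP (p %| a)%N; first by rewrite !(teichmuller0 Hom) ?pap.
case: (Hom a) => _ /(_ pa)[om1 oma].
apply: (teichmuller_uniq pr_p Habs Hom) => //; first by rewrite pap.
apply: (padic_abs_lt_dist Habs oma).
rewrite natrD opprD addNKr (padic_absN _ Habs).
by case: Habs => _ _ _ _ ->; apply: prime_invr_lt1.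
Qed.

Lemma teichmullerM (p : nat) (R : realType) (C : fieldType) (abs : C -> R)
    (omega : nat -> C) (a b : nat) :
  prime p -> padic_abs p abs -> teichmuller p abs omega ->
  omega (a * b)%N = omega a * omega b.
Proof.
move=> pr_p Habs Hom.
have [|] := boolP (p %| a * b)%N.
  move=> pab; rewrite (teichmuller0 Hom pab).
  by move: pab; rewrite Euclid_dvdM // => /orP[] /(teichmuller0 Hom) ->; rewrite ?mul0r ?mulr0.
move=> pab; move: (pab); rewrite Euclid_dvdM // negb_or => /andP[pa pb].
case: (Hom a) => _ /(_ pa)[oma1 oma]; case: (Hom b) => _ /(_ pb)[omb1 omb].
apply: (teichmuller_uniq pr_p Habs Hom) => //; first by rewrite exprMn oma1 omb1 mulr1.
apply: (@padic_abs_lt_dist _ _ _ _ _ (omega a * b%:R) _ _ Habs).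
  rewrite -mulrBr (padic_absM _ _ Habs) (teichmuller_abs1 pr_p Habs Hom pa).
  by rewrite mul1r.
by rewrite natrM -mulrBl (padic_absM _ _ Habs) (padic_abs_unit pr_p Habs pb) mulr1.
Qed.

Lemma teichmuller1 (p : nat) (R : realType) (C : fieldType) (abs : C -> R)
    (omega : nat -> C) :
  prime p -> padic_abs p abs -> teichmuller p abs omega -> omega 1%N = 1.
Proof.
move=> pr_p Habs Hom; apply: (teichmuller_uniq pr_p Habs Hom).
- by rewrite dvdn1 gtn_eqF ?prime_gt1.
- by rewrite expr1n.
- by rewrite subrr (padic_abs0 Habs).
Qed.

(** The definition of [omega] only gives a distance below 1. By [padic_abs_expB1] this distance
    equals that of [<a>^(p-1) = a^(p-1)] from 1, and [p] divides [a^(p-1) - 1]. *)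
Lemma teichmuller_quotient (p : nat) (R : realType) (C : fieldType) (abs : C -> R)
    (omega : nat -> C) (a : nat) :
  prime p -> padic_abs p abs -> teichmuller p abs omega -> ~~ (p %| a)%N ->
  abs (a%:R / omega a - 1) <= p%:R^-1.
Proof.
move=> pr_p Habs Hom pa.
have om_neq0 : omega a != 0 by rewrite (teichmuller_eq0 _ pr_p Habs Hom).
have near1 : abs (a%:R / omega a - 1) < 1.
  have -> (x : C) : abs x = abs (x * omega a).
    by rewrite (padic_absM _ _ Habs) (teichmuller_abs1 pr_p Habs Hom pa) mulr1.
  rewrite mulrBl divfK // mul1r (padic_absB _ _ Habs).
  by case: (Hom a) => _ /(_ pa)[].
rewrite -(padic_abs_expB1 pr_p Habs near1) exprMn exprVn.
rewrite (teichmuller_root1 Hom pa) invr1 mulr1 -natrX.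
have [c ->] := expn_predp_mod pr_p pa.
rewrite natrD addrK -[_^-1]expr1.
by apply: (padic_abs_dvd Habs); rewrite expn1 dvdn_mull.
Qed.

(** * Dirichlet characters and their twists *)

Lemma dchar_mod_eq (C : fieldType) (m a b : nat) (chi : nat -> C) :
  dchar_mod m chi -> a = b %[mod m] -> chi a = chi b.
Proof. by case=> _ per _ _ _; apply: periodic_modn. Qed.

Lemma dchar_eq0 (C : fieldType) (m a : nat) (chi : nat -> C) :
  dchar_mod m chi -> (chi a == 0) = ~~ coprime a m.
Proof. by case=> _ _ _ chi0 _; apply/eqP/idP => /chi0. Qed.

Lemma dcharX (C : fieldType) (m a n : nat) (chi : nat -> C) :
  dchar_mod m chi -> chi (a ^ n)%N = chi a ^+ n.
Proof.
by case=> _ _ chiM _ chi1; elim: n => [|n IH] //; rewrite expnS chiM IH exprS.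
Qed.

(** By Euler's theorem a nonzero value is a root of unity. *)
Lemma dchar_abs_le1 (p : nat) (R : realType) (C : fieldType) (abs : C -> R)
    (m a : nat) (chi : nat -> C) :
  padic_abs p abs -> dchar_mod m chi -> abs (chi a) <= 1.
Proof.
move=> Habs Hchi; have [m_gt0 _ _ _ chi1] := Hchi.
have [co_am|] := boolP (coprime a m); last first.
  by rewrite -(dchar_eq0 _ Hchi) => /eqP ->; rewrite (padic_abs0 Habs).
rewrite (padic_abs_root1 Habs (n := totient m)) ?totient_gt0 //.
rewrite -(dcharX _ _ Hchi) -chi1; apply: (dchar_mod_eq Hchi).
exact: Euler_exp_totient.
Qed.

(** With [n > 0], the convention [0^-1 = 0] makes [omega a ^- n] vanish exactly at the multiples of
    [p], which gives the product the zeros of a character modulo [lcm(f, p)]. *)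
Lemma dchar_twist (p : nat) (R : realType) (C : fieldType) (abs : C -> R)
    (f n : nat) (chi omega : nat -> C) :
  prime p -> padic_abs p abs -> teichmuller p abs omega -> dchar_mod f chi -> (0 < n)%N ->
  dchar_mod (lcmn f p) (fun a => chi a * omega a ^- n).
Proof.
move=> pr_p Habs Hom Hchi n_gt0; have [f_gt0 per chiM _ chi1] := Hchi.
split=> [|a|a b|a|].
- by rewrite lcmn_gt0 f_gt0 prime_gt0.
- have /dvdnP[c cE] := dvdn_lcml f p; rewrite {1}cE (periodic_mul per).
  have /dvdnP[d dE] := dvdn_lcmr f p; rewrite dE periodic_mul // => b.
  exact: (teichmuller_period _ pr_p Habs Hom).
- by rewrite chiM (teichmullerM _ _ pr_p Habs Hom) exprMn invfM mulrACA.
- have -> : coprime a (lcmn f p) = (chi a * omega a ^- n != 0).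
    rewrite mulf_eq0 invr_eq0 expf_eq0 n_gt0 negb_or (dchar_eq0 _ Hchi).
    rewrite (teichmuller_eq0 _ pr_p Habs Hom) negbK -prime_coprime // [coprime p a]coprime_sym.
    rewrite -coprimeMr; apply/idP/idP; last by apply: coprime_dvdr; rewrite -muln_lcm_gcd dvdn_mulr.
    move=> co; rewrite coprimeMr (coprime_dvdr (dvdn_lcml f p) co).
    exact: coprime_dvdr (dvdn_lcmr f p) co.
  by rewrite negbK; split=> /eqP.
- by rewrite chi1 (teichmuller1 pr_p Habs Hom) expr1n invr1 mulr1.
Qed.

(** The least divisor of [m] from which [theta] is induced works: a character inducing [psi] from a
    smaller modulus would induce [theta] as well. *)
Lemma primitive_char_exists (C : fieldType) (m : nat) (theta : nat -> C) :
  dchar_mod m theta ->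
  exists (g : nat) (psi : nat -> C),
    primitive_char g psi /\ forall a, coprime a m -> psi a = theta a.
Proof.
move=> Htheta.
pose P d := `[< (d %| m)%N /\ induced_from m d theta >].
have exP : exists d, P d.
  by exists m; apply/asboolP; split=> //; exists theta.
case: (ex_minnP exP) => g /asboolP[g_dvd [psi [Hpsi eq_psi]]] g_min.
exists g, psi; split=> [|a /eq_psi //]; split=> // d d_dvd d_lt [xi [Hxi eq_xi]].
have /g_min : P d.
  apply/asboolP; split; first exact: dvdn_trans d_dvd g_dvd.
  exists xi; split=> // a co_a; rewrite eq_psi // eq_xi //.
  exact: coprime_dvdr g_dvd co_a.
by rewrite leqNgt d_lt.
Qed.

(** * Primes dividing the conductor of a twist *)

Lemma coprime_mod_eq (a b m : nat) : a = b %[mod m] -> coprime a m = coprime b m.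
Proof. by move=> ab; rewrite -coprime_modl ab coprime_modl. Qed.

Lemma coprime_lift (f h a : nat) : (0 < f)%N -> (0 < h)%N -> coprime a f ->
  exists a' : nat, a' = a %[mod f] /\ coprime a' (f * h).
Proof.
(* The case [f = 1] is set apart because a number prime to 1 may be 0, while [pnatP] below asks for
   a positive [c]. *)
move=> f_gt0 h_gt0 co_af; have [->|f_neq1] := eqVneq f 1%N.
  by exists 1%N; rewrite !modn1 coprime1n.
(* [h2] is the part of [h] prime to [f]. Coprimality has to be imposed only there: keeping the class
   modulo [f] already avoids the primes of [f]. *)
pose h2 := (h`_(\pi(f)^'))%N.
have co_fh2 : coprime f h2.
  by apply: (@pnat_coprime \pi(f)); rewrite ?pnat_pi // part_pnat.
exists (chinese f h2 a 1); split; first exact: chinese_modl.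
set c := chinese f h2 a 1.
have co_cf : coprime c f by rewrite (coprime_mod_eq (chinese_modl co_fh2 a 1)).
rewrite coprimeMr co_cf -(partnC \pi(f) h_gt0) coprimeMr /=; apply/andP; split.
  rewrite coprime_sym; apply: (@pnat_coprime \pi(f)); first exact: part_pnat.
  apply/pnatP.
    by rewrite lt0n; apply: contraNneq f_neq1 => c0; have := co_cf; rewrite c0 /coprime gcd0n.
  move=> q pr_q q_c; rewrite inE /= mem_primes pr_q f_gt0 /=.
  apply/negP => q_f; have := dvdn_gcd q c f; rewrite q_c q_f (eqP co_cf) dvdn1.
  by move=> /eqP q1; rewrite q1 in pr_q.
by rewrite (coprime_mod_eq (chinese_modr co_fh2 a 1)) coprime1n.
Qed.

(* If [q] did not divide [h], the Chinese remainder theorem would let [a] be moved inside its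
   class modulo the prime-to-[q] part of [f] without changing [xi], hence without
   changing [chi]; so [chi] would be induced from that part. *)
Lemma primitive_char_dvd_prime (C : fieldType) (f h q : nat) (chi xi : nat -> C) :
  primitive_char f chi -> prime q -> (q %| f)%N -> (0 < h)%N ->
  (forall a, xi (a + h)%N = xi a) -> (forall a, coprime a (f * h) -> chi a = xi a) ->
  (q %| h)%N.
Proof.
move=> [Hchi prim] pr_q q_f h_gt0 per_xi eq_xi; apply/negPn/negP => q_h.
have [f_gt0 _ chiM _ chi1] := Hchi.
pose Q := (f`_q)%N; pose f1 := (f`_q^')%N.
have fE : f = (Q * f1)%N by rewrite /Q /f1 partnC.
have co_Qf1 : coprime Q f1 by apply: coprime_partC.
have co_Qh : coprime Q h by rewrite /Q p_part coprimeXl // prime_coprime.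
have co_f a : coprime a f = coprime a Q && coprime a f1 by rewrite fE coprimeMr.
have key a b : coprime a f -> coprime b f -> a = b %[mod f1] -> chi a = chi b.
  move=> co_a co_b ab.
  have [a' [a'E co_a']] := coprime_lift f_gt0 h_gt0 co_a.
  have co_m : coprime Q (f1 * h) by rewrite coprimeMr co_Qf1.
  (* [b'] is congruent to [b] modulo [f] and to [a'] modulo [h], whence [chi b = chi b' = xi b' = xi
     a' = chi a' = chi a]. The moduli are coprime because [q] is assumed not to divide [h]. *)
  pose b' := chinese Q (f1 * h) b a'.
  have b'Q : b' = b %[mod Q] by apply: chinese_modl.
  have b'h : b' = a' %[mod f1 * h] by apply: chinese_modr.
  have b'f1 : b' = b %[mod f1].
    have f1_f : (f1 %| f)%N by rewrite fE dvdn_mull.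
    have f1_m : (f1 %| f1 * h)%N by rewrite dvdn_mulr.
    rewrite -(modn_dvdm b' f1_m) b'h modn_dvdm //.
    by rewrite -(modn_dvdm a' f1_f) a'E modn_dvdm.
  have b'f : b' = b %[mod f].
    by apply/eqP; rewrite fE chinese_remainder // b'Q b'f1 !eqxx.
  have co_b' : coprime b' (f * h).
    rewrite fE -mulnA coprimeMr (coprime_mod_eq b'Q) (coprime_mod_eq b'h).
    move: co_b co_a'; rewrite co_f => /andP[-> _]; rewrite fE -mulnA coprimeMr.
    by case/andP.
  have b'xi : b' = a' %[mod h].
    have h_m : (h %| f1 * h)%N by rewrite dvdn_mull.
    by rewrite -(modn_dvdm b' h_m) b'h modn_dvdm.
  rewrite -(dchar_mod_eq Hchi a'E) -(dchar_mod_eq Hchi b'f) !eq_xi //.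
  by rewrite (periodic_modn per_xi b'xi).
(* The character modulo [f1] inducing [chi] will be [chi (c a)]: setting the component modulo [Q] to
   1 removes the zeros that [chi] has only because of [q]. *)
pose c a := chinese Q f1 1 a.
have cQ a : c a = 1 %[mod Q] by apply: chinese_modl.
have cf1 a : c a = a %[mod f1] by apply: chinese_modr.
have c_f a : coprime (c a) f = coprime a f1.
  by rewrite co_f (coprime_mod_eq (cQ a)) (coprime_mod_eq (cf1 a)) coprime1n.
have chi_c x y : x = y %[mod Q] -> x = y %[mod f1] -> chi x = chi y.
  move=> xyQ xyf1; apply: (dchar_mod_eq Hchi).
  by apply/eqP; rewrite fE chinese_remainder // xyQ xyf1 !eqxx.
have f1_dvd : (f1 %| f)%N by rewrite fE dvdn_mull.
have f1_gt0 : (0 < f1)%N by apply: dvdn_gt0 f1_dvd.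
apply: (prim f1) => //.
  rewrite [ltnRHS]fE ltn_Pmull // /Q p_part -(expn0 q) ltn_exp2l ?prime_gt1 //.
  by rewrite logn_gt0 mem_primes pr_q f_gt0.
exists (fun a => chi (c a)); split; last first.
  move=> a co_a; apply: (key a (c a)) => //.
  by rewrite c_f; move: co_a; rewrite co_f => /andP[].
split=> //.
- by move=> a; apply: chi_c; rewrite ?cQ ?cf1 // modnDr.
- move=> a b; rewrite -chiM; apply: chi_c.
    by rewrite cQ -modnMm !cQ modnMm.
  by rewrite cf1 -[RHS]modnMm !cf1 modnMm.
- by move=> a; rewrite -c_f -(dchar_eq0 _ Hchi); split=> /eqP.
- by rewrite -chi1; apply: chi_c; rewrite ?cQ ?cf1.
Qed.

(** The definition covers only [a] prime to [lcm(f, p)]. If a prime [q] divides both [a] and [f],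
    then [q != p], and [chi = psi omega^n] on integers prime to [f g p]; primitivity of [chi] forces
    [q] to divide [g p], hence [g], so both sides vanish at [a]. *)
Lemma is_chi_n_eq (p : nat) (R : realType) (C : fieldType) (abs : C -> R)
    (f n g : nat) (chi omega psi : nat -> C) :
  prime p -> padic_abs p abs -> teichmuller p abs omega -> primitive_char f chi ->
  is_chi_n p f chi omega n g psi ->
  forall a, ~~ (p %| a)%N -> psi a = chi a * omega a ^- n.
Proof.
move=> pr_p Habs Hom Hchi [[Hpsi _] eq_psi] a pa.
have [f_gt0 _ _ _ _] := Hchi.1; have [g_gt0 per_psi _ _ _] := Hpsi.
have co_ap : coprime a p by rewrite coprime_sym prime_coprime.
have lcm_dvd : (lcmn f p %| f * p)%N by rewrite -muln_lcm_gcd dvdn_mulr.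
have [co_af|nco_af] := boolP (coprime a f).
  by apply: eq_psi; apply: coprime_dvdr lcm_dvd _; rewrite coprimeMr co_af.
have chi0 : chi a = 0 by apply/eqP; rewrite (dchar_eq0 _ Hchi.1).
rewrite chi0 mul0r; apply/eqP; rewrite (dchar_eq0 _ Hpsi).
have gcd_gt1 : (1 < gcdn a f)%N.
  by rewrite ltn_neqAle eq_sym nco_af gcdn_gt0 f_gt0 orbT.
pose q := pdiv (gcdn a f); have pr_q : prime q by apply: pdiv_prime.
have /andP[q_a q_f] : (q %| a)%N && (q %| f)%N by rewrite -dvdn_gcd pdiv_dvd.
have : (q %| g * p)%N.
  apply: (primitive_char_dvd_prime (xi := fun b => psi b * omega b ^+ n) Hchi) => //.
  - by rewrite muln_gt0 g_gt0 prime_gt0.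
  - move=> b; rewrite {1}[(g * p)%N]mulnC (periodic_mul per_psi).
    by rewrite (periodic_mul (fun b => teichmuller_period b pr_p Habs Hom)).
  - move=> b; rewrite !coprimeMr => /and3P[co_bf _ co_bp].
    rewrite eq_psi; last by apply: coprime_dvdr lcm_dvd _; rewrite coprimeMr co_bf.
    rewrite divfK // expf_neq0 // (teichmuller_eq0 _ pr_p Habs Hom).
    by rewrite -prime_coprime // coprime_sym.
rewrite Euclid_dvdM // [(q %| p)%N]dvdn_prime2 // orbC; case: eqP => [qp|_ /= q_g].
  by rewrite -qp q_a in pa.
apply/negP => co_ag; have := dvdn_gcd q a g.
by rewrite q_a q_g (eqP co_ag) dvdn1 => /eqP q1; rewrite q1 in pr_q.
Qed.

(** Since 2 is prime to the odd number [lcm(f, p)], the twist, and hence [psi], is nonzero at 2. *)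
Lemma is_chi_n_odd (p : nat) (R : realType) (C : fieldType) (abs : C -> R)
    (f n g : nat) (chi omega psi : nat -> C) :
  prime p -> odd p -> odd f -> padic_abs p abs -> teichmuller p abs omega ->
  dchar_mod f chi -> (0 < n)%N -> is_chi_n p f chi omega n g psi -> odd g.
Proof.
move=> pr_p odd_p odd_f Habs Hom Hchi n_gt0 [[Hpsi _] eq_psi].
rewrite -coprime2n -[coprime _ _]negbK -(dchar_eq0 _ Hpsi).
have co2 : coprime 2 (lcmn f p).
  rewrite (@coprime_dvdr _ (f * p)) //; first by rewrite -muln_lcm_gcd dvdn_mulr.
  by rewrite coprime2n oddM odd_f.
rewrite eq_psi //; have /= := dchar_eq0 2 (dchar_twist pr_p Habs Hom Hchi n_gt0).
by rewrite co2 => ->.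
Qed.

(** * The Euler factor at [p] and congruences between twisted Euler numbers *)

Lemma sum_nat_dvd (V : nmodType) (F : nat -> V) (p m : nat) : (0 < p)%N ->
  \sum_(1 <= a < (m * p).+1 | (p %| a)%N) F a = \sum_(1 <= b < m.+1) F (b * p)%N.
Proof.
case: p => // p _; elim: m => [|m IH]; first by rewrite !big_geq.
rewrite (big_cat_nat (n := (m * p.+1).+1)) //=; last by rewrite ltnS leq_mul2r leqnSn orbT.
rewrite IH [RHS]big_nat_recr //=; congr (_ + _).
have -> : (m.+1 * p.+1 = m * p.+1 + p.+1)%N by rewrite mulSn addnC.
rewrite addnS big_mkcond big_nat_recr /=; last by rewrite ltnS leq_addr.
rewrite -addnS dvdn_addr ?dvdn_mull // dvdnn.
rewrite big_nat_cond big1 ?add0r // => a /andP[/andP[lo hi] _].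
case: ifP => // /dvdnP[c ac].
have lt_c : (c < m.+1)%N by rewrite -(ltn_pmul2r (ltn0Sn p)) -ac mulSnr.
by move: lo; rewrite ac ltn_pmul2r // ltnNge -ltnS lt_c.
Qed.


(** The terms [a = p b] reproduce the shorter sum up to the factor [p^n psi(p)]; their signs agree
    because [p] is odd. *)
Lemma euler_S_remove_p (C : fieldType) (p m n : nat) (psi theta : nat -> C) :
  (0 < p)%N -> odd p -> (forall a b, psi (a * b)%N = psi a * psi b) ->
  (forall a, (p %| a)%N -> theta a = 0) -> (forall a, ~~ (p %| a)%N -> psi a = theta a) ->
  euler_S (m * p) psi n =
  euler_S (m * p) theta n + p%:R ^+ n * psi p * euler_S m psi n.
Proof.
move=> p_gt0 odd_p psiM theta0 eq_theta; rewrite {1}/euler_S.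
rewrite (bigID (fun a => (p %| a)%N)) /= addrC; congr (_ + _).
  rewrite /euler_S [RHS](bigID (fun a => (p %| a)%N)) /= [X in _ = X + _]big1 ?add0r.
    by apply: eq_bigr => a /eq_theta ->.
  by move=> a /theta0 ->; rewrite mulr0 mul0r.
rewrite (sum_nat_dvd (fun a => (-1) ^+ a * psi a * a%:R ^+ n)) // /euler_S mulr_sumr.
apply: eq_bigr => b _.
by rewrite psiM mulnC exprM -[(-1) ^+ p]signr_odd odd_p expr1 natrM exprMn; ring.
Qed.

(** Passing to the possibly imprimitive twist modulo [lcm(f, p)] absorbs the Euler factor and gives
    the values to interpolate one formula in [n], free of [g] and [psi]. *)
Lemma euler_num_is_chi_n (p : nat) (R : realType) (C : fieldType) (abs : C -> R)
    (f n g : nat) (chi omega psi : nat -> C) :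
  prime p -> odd p -> padic_abs p abs -> primitive_char f chi -> odd f ->
  teichmuller p abs omega -> (0 < n)%N -> is_chi_n p f chi omega n g psi ->
  (1 - p%:R ^+ n * psi p) * euler_num g psi n =
  euler_num (lcmn f p) (fun a => chi a * omega a ^- n) n.
Proof.
move=> pr_p odd_p Habs Hchi odd_f Hom n_gt0 Hpsi_n; set theta := fun a => _.
have Htheta : dchar_mod (lcmn f p) theta.
  exact: dchar_twist pr_p Habs Hom Hchi.1 n_gt0.
have odd_g := is_chi_n_odd pr_p odd_p odd_f Habs Hom Hchi.1 n_gt0 Hpsi_n.
have eq_psi := is_chi_n_eq pr_p Habs Hom Hchi Hpsi_n.
have Hpsi := Hpsi_n.1.1; have [_ per_psi psiM _ _] := Hpsi.
have [_ per_theta _ _ _] := Htheta.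
have psi1 a := dchar_abs_le1 a Habs Hpsi.
have theta1 a := dchar_abs_le1 a Habs Htheta.
(* [m] is an odd multiple of the period [g] of [psi], [m p] is also an odd multiple of [lcm(f, p)],
   and [p^k] divides both; so the three sums below are within [p^-k] of their Euler numbers. *)
apply: (padic_abs_eq pr_p Habs) => k; pose m := (f * p ^ k * g)%N.
have odd_pk : odd (p ^ k) by rewrite oddX odd_p orbT.
have lcm_dvd : (lcmn f p %| m * p)%N.
  apply: (@dvdn_trans (f * p)); first by rewrite -muln_lcm_gcd dvdn_mulr.
  by rewrite dvdn_mul // /m -mulnA dvdn_mulr.
have /dvdnP[r mE] := lcm_dvd.
have /andP[odd_r odd_lcm] : odd r && odd (lcmn f p).
  by rewrite -oddM -mE !oddM odd_f odd_pk odd_g odd_p.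
have pk_m : (p ^ k %| m)%N by rewrite /m mulnAC dvdn_mull.
have pk_mp : (p ^ k %| m * p)%N by rewrite dvdn_mulr.
have approx_m : abs (euler_S m psi n - euler_num g psi n) <= p%:R^-1 ^+ k.
  by apply: (euler_num_approx n pr_p) => //; rewrite oddM odd_f.
have approx_mp : abs (euler_S (m * p) psi n - euler_num g psi n) <= p%:R^-1 ^+ k.
  have mpE : (m * p = f * p ^ k * p * g)%N by rewrite /m mulnAC.
  rewrite mpE; apply: (euler_num_approx n pr_p) => //; last by rewrite -mpE.
  by rewrite !oddM odd_f odd_pk.
have approx_theta : abs (euler_S (m * p) theta n - euler_num (lcmn f p) theta n) <= p%:R^-1 ^+ k.
  by rewrite mE; apply: (euler_num_approx n pr_p) => //; rewrite -mE.
have theta0 a : (p %| a)%N -> theta a = 0.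
  by move=> pa; rewrite /theta (teichmuller0 Hom pa) expr0n gtn_eqF // invr0 mulr0.
have SE := euler_S_remove_p m n (prime_gt0 pr_p) odd_p psiM theta0 eq_psi.
have -> : (1 - p%:R ^+ n * psi p) * euler_num g psi n - euler_num (lcmn f p) theta n
  = (p%:R ^+ n * psi p) * (euler_S m psi n - euler_num g psi n)
    + (euler_S (m * p) theta n - euler_num (lcmn f p) theta n)
    - (euler_S (m * p) psi n - euler_num g psi n) by rewrite SE; ring.
apply: (padic_abs_leB Habs) => //; apply: (padic_abs_leD Habs) => //.
apply: (padic_abs_leM Habs) => //; apply: (padic_abs_leM Habs) => //.
exact: padic_abs_leX _ Habs (padic_abs_nat _ Habs).
Qed.

(** Both Euler numbers are approximated by sums over one range, whose terms at [a] prime to [p]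
    differ by [(-1)^a chi(a) (<a>^m - <a>^n)]. *)
Lemma euler_num_twist_congr (p : nat) (R : realType) (C : fieldType) (abs : C -> R)
    (f k m n : nat) (chi omega : nat -> C) :
  prime p -> odd p -> padic_abs p abs -> dchar_mod f chi -> odd f ->
  teichmuller p abs omega -> (0 < m)%N -> (0 < n)%N -> m = n %[mod p ^ k] ->
  abs (euler_num (lcmn f p) (fun a => chi a * omega a ^- m) m -
       euler_num (lcmn f p) (fun a => chi a * omega a ^- n) n) <= p%:R^-1 ^+ k.
Proof.
move=> pr_p odd_p Habs Hchi odd_f Hom m_gt0 n_gt0 mn; set F := lcmn f p.
have odd_F : odd F.
  have /dvdnP[c cE] : (F %| f * p)%N by rewrite -muln_lcm_gcd dvdn_mulr.
  have : odd (c * F) by rewrite -cE oddM odd_f.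
  by rewrite oddM => /andP[].
have approx i : (0 < i)%N ->
    abs (euler_S (p ^ k * F) (fun a => chi a * omega a ^- i) i
         - euler_num F (fun a => chi a * omega a ^- i) i) <= p%:R^-1 ^+ k.
  move=> i_gt0; have Hi := dchar_twist pr_p Habs Hom Hchi i_gt0.
  apply: (euler_num_approx i pr_p) => //; last exact: dvdn_mulr.
  - by move=> a; apply: (dchar_abs_le1 a Habs Hi).
  - by rewrite oddX odd_p orbT.
  - by case: Hi.
apply: (padic_abs_le_dist Habs (y := euler_S (p ^ k * F) (fun a => chi a * omega a ^- m) m)).
  by rewrite (padic_absB _ _ Habs) approx.
apply: (padic_abs_le_dist Habs _ (approx n n_gt0)).
rewrite /euler_S -sumrB; apply: (padic_abs_le_sum _ Habs) => [|a].
  by rewrite exprn_ge0 ?invr_ge0.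
have [pa|pa] := boolP (p %| a)%N.
  rewrite (teichmuller0 Hom pa) !expr0n !gtn_eqF // !invr0 !mulr0 !mul0r subrr.
  by rewrite (padic_abs0 Habs) exprn_ge0 ?invr_ge0.
have -> : (-1) ^+ a * (chi a * omega a ^- m) * a%:R ^+ m
    - (-1) ^+ a * (chi a * omega a ^- n) * a%:R ^+ n
  = (-1) ^+ a * chi a * ((a%:R / omega a) ^+ m - (a%:R / omega a) ^+ n).
  by rewrite !exprMn !exprVn; ring.
apply: (padic_abs_leM Habs); last first.
  exact: padic_abs_exp_sub (teichmuller_quotient pr_p Habs Hom pa) mn.
apply: (padic_abs_leM Habs); last exact: dchar_abs_le1 Habs Hchi.
by apply: (padic_abs_leX _ Habs); rewrite (padic_absN _ Habs) (padic_abs1 Habs).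
Qed.

(** * Approximation of [p]-adic integers by the integers [1 - n] *)

Lemma zp_seq_mod (p : nat) (x : PadicInt p) (j k : nat) :
  (j <= k)%N -> (zp_seq x k %% p ^ j)%N = zp_seq x j.
Proof.
elim: k => [|k IH].
  rewrite leqn0 => /eqP ->; rewrite expn0 modn1.
  by case: (zp_seq x 0) (zp_lt x 0).
rewrite leq_eqVlt => /orP[/eqP ->|jk]; first by rewrite modn_small ?zp_lt.
by move: jk; rewrite ltnS => jk; rewrite -(modn_dvdm _ (dvdn_exp2l p jk)) zp_compat IH.
Qed.

(* A positive integer congruent to [1 - x] modulo [p ^ k]. *)
Definition zp_approx (p : nat) (x : PadicInt p) (k : nat) : nat :=
  (p ^ k - zp_seq x k).+1.

Lemma zp_approx_congr (p : nat) (x : PadicInt p) (j k : nat) :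
  (j <= k)%N -> zp_approx x k = zp_approx x j %[mod p ^ j].
Proof.
(* Adding [zp_seq x k] to both sides clears the truncated subtraction. *)
move=> jk; apply/eqP; rewrite /zp_approx -(eqn_modDr (zp_seq x k)) !addSn.
rewrite subnK; last by rewrite ltnW ?zp_lt.
have := divn_eq (zp_seq x k) (p ^ j); rewrite zp_seq_mod // => xk.
rewrite [in X in _ == X %[mod _]]xk addnCA subnK; last by rewrite ltnW ?zp_lt.
rewrite -[(p ^ k).+1]addn1 -[(_ + _).+1]addn1 eqn_modDr modnMDl modnn.
exact: dvdn_exp2l.
Qed.

Lemma zp_approx_int (p : nat) (x : PadicInt p) (n k : nat) : (0 < p)%N ->
  zp_is_int x (1 - n%:Z) -> zp_approx x k = n %[mod p ^ k].
Proof.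
move=> p_gt0 /(_ k) xk; apply/eqP; rewrite /zp_approx.
rewrite -(eqn_modDr (zp_seq x k)) addSn subnK; last by rewrite ltnW ?zp_lt.
rewrite -[(p ^ k).+1]addn1 modnDl -eqz_nat -!modz_nat PoszD xk modzDmr.
by rewrite addrCA subrr addr0.
Qed.

(** Together with [zp_of_int] this is the density of the integers [1 - n], [n >= 1]: each class
    modulo [p^k] contains one. *)
Lemma zp_seq_approx (p : nat) (x y : PadicInt p) (k : nat) :
  zp_is_int y (1 - (zp_approx x k)%:Z) -> zp_seq y k = zp_seq x k.
Proof.
move=> /(_ k) yk; apply/eqP; rewrite -eqz_nat yk -modzDr /zp_approx -addn1.
rewrite PoszD -subzn; last by rewrite ltnW ?zp_lt.
have -> : 1 - ((p ^ k)%:Z - (zp_seq x k)%:Z + 1) + (p ^ k)%:Z = (zp_seq x k)%:Z by ring.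
by rewrite modz_small // ltz_nat zp_lt.
Qed.

Lemma zp_of_int (p : nat) (z : int) : (0 < p)%N -> exists x : PadicInt p, zp_is_int x z.
Proof.
move=> p_gt0.
have pk_neq0 k : (p ^ k)%:Z != 0 by rewrite eqz_nat -lt0n expn_gt0 p_gt0.
pose s k := `|(z %% (p ^ k)%:Z)%Z|%N.
have sE k : (s k)%:Z = (z %% (p ^ k)%:Z)%Z by rewrite /s gez0_abs ?modz_ge0.
have s_lt k : (s k < p ^ k)%N.
  by rewrite -ltz_nat sE ltz_pmod // ltz_nat expn_gt0 p_gt0.
have s_compat k : (s k.+1 %% p ^ k)%N = s k.
  apply/eqP; rewrite -eqz_nat -modz_nat !sE; apply/eqP.
  by rewrite [in RHS](divz_eq z (p ^ k.+1)%:Z) expnS PoszM mulrA modzMDl.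
by exists (MkPadicInt s_lt s_compat) => k; rewrite -sE.
Qed.

(** * Existence by completeness, uniqueness by density *)

Theorem theorem5p4 (R : realType) (C : closedFieldType) (abs : C -> R)
  (p f : nat) (chi omega : nat -> C) :
  prime p -> odd p ->
  padic_abs p abs -> abs_complete abs ->
  primitive_char f chi -> odd f ->
  teichmuller p abs omega ->
  (exists L : PadicInt p -> C, zp_continuous abs L /\ euler_interp f chi omega L) /\
  (forall L1 L2 : PadicInt p -> C,
      zp_continuous abs L1 -> euler_interp f chi omega L1 ->
      zp_continuous abs L2 -> euler_interp f chi omega L2 ->
      forall x : PadicInt p, L1 x = L2 x).
Proof.
move=> pr_p odd_p Habs Hcomplete Hchi odd_f Hom.
have p_gt0 := prime_gt0 pr_p.
split.
  pose E n := euler_num (lcmn f p) (fun a => chi a * omega a ^- n) n.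
  have congrE k m n : (0 < m)%N -> (0 < n)%N -> m = n %[mod p ^ k] ->
      abs (E m - E n) <= p%:R^-1 ^+ k.
    exact: euler_num_twist_congr pr_p odd_p Habs Hchi.1 odd_f Hom.
  (* The approximants of [1 - x] give a Cauchy sequence of values. The rate [p^-k] is the same for
     all [x], which is what yields continuity of the limit. *)
  have lim_ex (x : PadicInt p) : exists l : C, forall k, abs (l - E (zp_approx x k)) <= p%:R^-1 ^+ k.
    have [|l l_lim] := Hcomplete (fun k => E (zp_approx x k)).
      move=> eps /(prime_invX_lt pr_p)[N N_eps]; exists N => i j Ni Nj.
      apply: le_lt_trans N_eps; apply: congrE => //.
      by rewrite (zp_approx_congr x Ni) (zp_approx_congr x Nj).
    exists l => k; have pk_gt0 : 0 < (p%:R : R)^-1 ^+ k.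
      by rewrite exprn_gt0 // invr_gt0 ltr0n.
    have [N l_N] := l_lim _ pk_gt0.
    apply: (padic_abs_le_dist Habs (y := E (zp_approx x (maxn N k)))).
      by rewrite (padic_absB _ _ Habs) ltW // l_N // leq_maxl.
    by apply: congrE => //; apply: zp_approx_congr; rewrite leq_maxr.
  have [L L_lim] := choice lim_ex.
  exists L; split.
    move=> x eps /(prime_invX_lt pr_p)[k k_eps]; exists k => y xy.
    apply: le_lt_trans k_eps.
    (* Since [x] and [y] agree modulo [p^k], they have the same approximant at level [k], and both
       limits are close to its value. *)
    apply: (padic_abs_le_dist Habs (L_lim y k)).
    by rewrite /zp_approx xy (padic_absB _ _ Habs) L_lim.
  move=> n n_gt0 x x_int g psi Hpsi.
  rewrite (euler_num_is_chi_n pr_p odd_p Habs Hchi odd_f Hom n_gt0 Hpsi).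
  apply: (padic_abs_eq pr_p Habs) => k.
  apply: (padic_abs_le_dist Habs (L_lim x k)).
  by apply: congrE => //; apply: zp_approx_int.
move=> L1 L2 cont1 int1 cont2 int2 x.
have near_eq eps : 0 < eps -> abs (L1 x - L2 x) < eps.
  move=> eps_gt0.
  have [k1 near1] := cont1 x _ eps_gt0; have [k2 near2] := cont2 x _ eps_gt0.
  pose k := maxn k1 k2; pose n := zp_approx x k.
  (* A point [1 - n] that is close to [x] for both moduli of continuity and at which both functions
     are prescribed. *)
  have [y y_int] := zp_of_int (1 - n%:Z) p_gt0.
  have yx : zp_seq y k = zp_seq x k by apply: zp_seq_approx.
  have yxj j : (j <= k)%N -> zp_seq y j = zp_seq x j.
    by move=> jk; rewrite -(zp_seq_mod y jk) yx zp_seq_mod.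
  have eq_y : L1 y = L2 y.
    (* [euler_interp] quantifies over all representatives [psi] of [chi_n], so it determines the
       value at [1 - n] only once one is exhibited. [n] is a successor by definition of [zp_approx],
       so [n.-1.+1] is [n] by computation. *)
    have [g [psi Hpsi]] := primitive_char_exists (dchar_twist pr_p Habs Hom Hchi.1 (ltn0Sn n.-1)).
    by rewrite (int1 n _ y y_int g psi Hpsi) // (int2 n _ y y_int g psi Hpsi).
  apply: (padic_abs_lt_dist Habs (y := L1 y)).
    by rewrite (padic_absB _ _ Habs) near1 // yxj // leq_maxl.
  by rewrite eq_y near2 // yxj // leq_maxr.
apply: (padic_abs_eq pr_p Habs) => k; apply/ltW/near_eq.
by rewrite exprn_gt0 // invr_gt0 ltr0n.
Qed.
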